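(* Let $(P_n(x))_{n\in\mathbb{N}_0}\subseteq\mathbb{R}[x]$ be a sequence given by $P_0(x)=1$, $P_1(x)=x$, $xP_n(x)=a_nP_{n+1}(x)+c_nP_{n-1}(x)$ $(n\in\mathbb{N})$ with $(c_n)_{n\in\mathbb{N}}\subseteq(0,1)$ and $a_n=1-c_n$, and assume that $(P_n(x))_{n\in\mathbb{N}_0}$ satisfies nonnegative linearization of products. For every $n\in\mathbb{N}_0$, let $C_n(0),\ldots,C_n(n)$ be the connection coefficients to the Chebyshev polynomials of the first kind $(T_k(x))_{k\in\mathbb{N}_0}$, i.e., $P_n(x)=\sum_{k=0}^nC_n(k)T_k(x)$. If all connection coefficients $C_n(0),\ldots,C_n(n)$ $(n\in\mathbb{N}_0)$ are nonnegative, then $h(n)\geq 2$ for all $n\in\mathbb{N}$.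
   Context: $\mathbb{N}=\{1,2,3,\ldots\}$ and $\mathbb{N}_0=\mathbb{N}\cup\{0\}$. A sequence $(P_n(x))_{n\in\mathbb{N}_0}$ given by such a recurrence satisfies $\deg P_n=n$ and $P_n(1)=1$ for all $n$, and it is orthogonal with respect to a unique probability Borel measure $\mu$ on $\mathbb{R}$, meaning that $\int_{\mathbb{R}}P_m(x)P_n(x)\,\mathrm{d}\mu(x)\neq 0\Leftrightarrow m=n$. Nonnegative linearization of products means that in the (unique) expansions $P_m(x)P_n(x)=\sum_{k=0}^{m+n}g(m,n;k)P_k(x)$ all coefficients $g(m,n;k)$ $(m,n,k\in\mathbb{N}_0)$ are nonnegative. The Haar function is $h(n):=1/g(n,n;0)=1/\int_{\mathbb{R}}P_n^2(x)\,\mathrm{d}\mu(x)$; equivalently, $h(0)=1$ and $h(n)=\prod_{k=1}^n a_{k-1}/c_k$ for $n\in\mathbb{N}$, where $a_0:=1$. The Chebyshev polynomials of the first kind are given by $T_n(\cos\varphi)=\cos(n\varphi)$. *)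

(* Defs.v *)
From HB Require Import structures.
From mathcomp Require Import all_boot all_order all_algebra.
From mathcomp Require Import all_classical all_reals all_analysis.
Set Implicit Arguments.
Unset Strict Implicit.
Unset Printing Implicit Defensive.
Import Order.TTheory GRing.Theory Num.Theory.

Local Open Scope ring_scope.

(* The sequences a and c are indexed by the positive integers: their values at
   0 are not constrained. *)
Definition recurrence_sequence (R : realType) (a c : nat -> R)
    (P : nat -> {poly R}) : Prop :=
  [/\ P 0%N = 1,
      P 1%N = 'X,
      (forall n, (1 <= n)%N -> 'X * P n = a n *: P n.+1 + c n *: P n.-1),
      (forall n, (1 <= n)%N -> 0 < c n < 1)
    & (forall n, (1 <= n)%N -> a n = 1 - c n)].

(* When size (P n) = n.+1 for all n, P is a basis of {poly R}, so such g exists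
   and its values g m n k with k <= m + n are uniquely determined. *)
Definition linearization_coefficients (R : realType) (P : nat -> {poly R})
    (g : nat -> nat -> nat -> R) : Prop :=
  forall m n, P m * P n = \sum_(k < (m + n).+1) g m n k *: P k.

Definition nonneg_linearization (R : realType) (P : nat -> {poly R})
    (g : nat -> nat -> nat -> R) : Prop :=
  linearization_coefficients P g /\
  (forall m n k, (k <= m + n)%N -> 0 <= g m n k).

Definition haar (R : realType) (g : nat -> nat -> nat -> R) (n : nat) : R :=
  1 / g n n 0%N.

(* This determines T uniquely, a polynomial being determined by its values on
   the infinite set [-1, 1]. *)
Definition chebyshev_first_kind (R : realType) (T : nat -> {poly R}) : Prop :=
  forall (n : nat) (phi : R), (T n).[cos phi] = cos (n%:R * phi).

Definition connection_coefficients (R : realType) (P T : nat -> {poly R})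
    (C : nat -> nat -> R) : Prop :=
  forall n, P n = \sum_(k < n.+1) C n k *: T k.

(* Main.v *)
(** Let [E] be the expectation with respect to the arcsine law, under which
    [E (T j * T k)] is [0] for [j <> k], [1/2] for [j = k > 0] and [1] for
    [j = k = 0].  Since [E (P k) = C k 0 >= 0], applying [E] to
    [P n ^ 2 = \sum_k g n n k P k] gives
    [g n n 0 <= E (P n ^ 2) = C n 0 ^ 2 + 1/2 \sum_(k > 0) C n k ^ 2].
    The weights [C n k] sum to [P n 1 = 1].  Moreover [C n 0 <= 1/2]: the
    polynomial [P n] vanishes somewhere on [[-1, 1]], where it is at least
    [C n 0 - \sum_(k > 0) C n k].  Hence the right-hand side is at most
    [1/2 \sum_k C n k = 1/2].

    For polynomials of degree less than [N] the expectation [E] is the average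
    over the points [cos (2 pi j / N)], [j < N]. *)
Require Import Defs.
From mathcomp Require Import all_boot all_order all_algebra.
From mathcomp Require Import all_classical all_reals all_analysis.
From mathcomp Require Import zify ring lra polyrcf.
Import Order.TTheory GRing.Theory Num.Theory.

Set Implicit Arguments.
Unset Strict Implicit.

Local Open Scope ring_scope.

(* The paper sets [a 0 = 1]; here [a 0] is unconstrained, so [1] is substituted. *)
Definition haar_inv (R : realType) (a c : nat -> R) (n : nat) : R :=
  \prod_(k < n) (c k.+1 / (if val k == 0%N then 1 else a k)).

(** * Values and zeros of the orthogonal polynomials *)

Section Recurrence.
Variables (R : realType) (a c : nat -> R) (P : nat -> {poly R}).
Hypothesis hP : recurrence_sequence a c P.

Lemma recurrence_a_gt0 n : (0 < n)%N -> 0 < a n.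
Proof.
by case: hP => _ _ _ hc ha n0; rewrite ha //; have := hc _ n0; lra.
Qed.

Lemma recurrence_horner n x :
  x * (P n.+1).[x] = a n.+1 * (P n.+2).[x] + c n.+1 * (P n).[x].
Proof.
case: hP => _ _ /(_ n.+1 isT) /(congr1 (fun p => p.[x])) + _ _.
by rewrite !hornerE.
Qed.

Lemma recurrence_horner1 n : (P n).[1] = 1.
Proof.
suff: (P n).[1] = 1 /\ (P n.+1).[1] = 1 by case.
case: (hP) => P0 P1 _ _ ha; elim: n => [|n [IH1 IH2]].
  by rewrite P0 P1 !hornerE.
split=> //; have := recurrence_horner n 1; rewrite IH1 IH2.
have a_gt0 := @recurrence_a_gt0 n.+1 isT; have := ha n.+1 isT.
move: (c n.+1) (a n.+1) (P n.+2).[1] a_gt0 => u v p v0 vE e.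
apply: (mulfI (lt0r_neq0 v0)); lra.
Qed.

(* By induction: [P n.+2] is negative at the largest zero of [P n.+1] and is [1]
   at [1], so its own largest zero lies strictly in between. *)
Lemma recurrence_largest_root n :
  exists z, [/\ 0 <= z < 1, (P n.+1).[z] = 0, 0 < (P n).[z]
             & forall x, z < x <= 1 -> 0 < (P n.+1).[x]].
Proof.
case: (hP) => P0 P1 _ hc _; elim: n => [|n [z [/andP[z0 z1] Pz Pz' Pgt]]].
  exists 0; rewrite P0 P1 !hornerE; split; rewrite ?lexx ?ltr01 //.
  by move=> x /andP[x0 _]; rewrite hornerX.
have Pz_lt0 : (P n.+2).[z] < 0.
  have := recurrence_horner n z; rewrite Pz mulr0 => e.
  have /andP[cn _] := hc n.+1 isT; have an := @recurrence_a_gt0 n.+1 isT.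
  rewrite -(pmulr_rlt0 _ an).
  by have := mulr_gt0 cn Pz'; lra.
have P1_gt0 : 0 < (P n.+2).[1] by rewrite recurrence_horner1.
have Pneq0 : P n.+2 != 0.
  by apply: contraTneq P1_gt0 => ->; rewrite horner0 ltxx.
(* With no root in []y, 1[], the value at [1] fixes the sign: a nonpositive value at [x] would force
   a root in between. *)
have pos y : z <= y < 1 -> {in `]y, 1[, forall x, ~~ root (P n.+2) x} ->
    forall x, y < x <= 1 -> 0 < (P n.+2).[x].
  move=> /andP[zy y1] noroot x /andP[yx x1]; rewrite ltNge; apply/negP => Px.
  have Px1 : (P n.+2).[x] <= 0 <= (P n.+2).[1] by rewrite Px ltW.
  have [w /andP[xw w1] rw] := poly_ivt x1 Px1.
  have w1' : w < 1.
    rewrite lt_neqAle w1 andbT; apply: contraTneq rw => ->.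
    by rewrite rootE gt_eqF.
  by have := noroot w; rewrite in_itv /= (lt_le_trans yx xw) w1' rw => /(_ isT).
(* Either there is a last root in []z, 1[], or none; the latter contradicts the sign change between
   [z] and [1]. *)
have := prev_rootP (P n.+2) z 1.
move: (prev_root _ _ _) (_ == 0) => y b; case.
- by move=> p0; rewrite p0 eqxx in Pneq0.
- move=> {}y _ Py /[!in_itv]/andP[/= zy y1] noroot.
  exists y; split=> //; first by rewrite (le_trans z0 (ltW zy)) y1.
    by apply: Pgt; rewrite zy ltW.
  by apply: pos => //; rewrite y1 ltW.
move=> d _ _ noroot.
have posz := pos z; rewrite lexx z1 in posz.
have Pz1 : (P n.+2).[z] <= 0 <= (P n.+2).[1] by rewrite !ltW.
have [w /andP[zw w1] rw] := poly_ivt (ltW z1) Pz1.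
have zw' : z < w.
  rewrite lt_neqAle zw andbT; apply: contraTneq rw => <-.
  by rewrite rootE lt_eqF.
by have := posz isT noroot w; rewrite zw' w1 (eqP rw) ltxx => /(_ isT).
Qed.

Lemma haar_inv_gt0 n : 0 < haar_inv a c n.
Proof.
case: hP => _ _ _ hc _; apply: prodr_gt0 => k _; apply: divr_gt0.
  by case/andP: (hc k.+1 isT).
by case: eqP => // /eqP k0; rewrite recurrence_a_gt0 // lt0n.
Qed.

(** * The truncated Jacobi matrix and the constant term of a square *)

Variable N : nat.

(* Multiplication by ['X] in the basis [P], truncated to degree at most [N]. *)
Let A : 'M[R]_N.+1 := \matrix_(i, j)
  if val j == i.+1 then (if val i == 0%N then 1 else a i)
  else if val i == j.+1 then c i else 0.
(** Indexing by [nat] makes [e k] zero for [k > N], so the recurrences below also hold at the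
    truncated edge. *)
Let e k : 'rV[R]_N.+1 := \row_j (val j == k)%:R.

Let eA k (i : 'I_N.+1) : val i = k -> e k *m A = row i A.
Proof.
move=> <-; rewrite rowE; congr (_ *m _); apply/rowP => j.
by rewrite !mxE /= -val_eqE.
Qed.

Let eA0 : e 0 *m A = e 1.
Proof.
rewrite (eA (i := ord0) erefl) //; apply/rowP => j; rewrite !mxE /=.
by case: eqP.
Qed.

Let eAS k : (k < N)%N -> e k.+1 *m A = a k.+1 *: e k.+2 + c k.+1 *: e k.
Proof.
rewrite -ltnS => kN; rewrite (eA (i := Ordinal kN) erefl) //; apply/rowP => j.
rewrite !mxE /= eqSS [k == j]eq_sym.
have [->|_] := eqVneq (val j) k.+2; first by rewrite gtn_eqF // mulr1 mulr0 addr0.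
by rewrite mulr0 add0r; case: eqP; rewrite ?mulr1 ?mulr0.
Qed.

Let Ae k (i : 'I_N.+1) : val i = k -> A *m (e k)^T = col i A.
Proof.
move=> <-; rewrite colE; congr (_ *m _); apply/colP => j.
by rewrite /e !mxE eqxx andbT -val_eqE.
Qed.

Let Ae0 : A *m (e 0)^T = c 1 *: (e 1)^T.
Proof.
rewrite (Ae (i := ord0) erefl) //; apply/colP => j; rewrite /e !mxE /=.
by case: eqP => [->|]; rewrite ?mulr1 ?mulr0.
Qed.

Let AeS k : (k < N)%N -> A *m (e k.+1)^T =
  (if k == 0%N then 1 else a k) *: (e k)^T + c k.+2 *: (e k.+2)^T.
Proof.
rewrite -ltnS => kN; rewrite (Ae (i := Ordinal kN) erefl) //; apply/colP => j.
rewrite /e !mxE /= eqSS [k == j]eq_sym.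
have [->|_] := eqVneq (val j) k; first by rewrite [k == k.+2]ltn_eqF // mulr1 mulr0 addr0.
by rewrite mulr0 add0r; case: eqP => [->|]; rewrite ?mulr1 ?mulr0.
Qed.

Let horner_mx_recurrence k : horner_mx A (P k.+2) =
  (a k.+1)^-1 *: (A *m horner_mx A (P k.+1) - c k.+1 *: horner_mx A (P k)).
Proof.
have a_neq0 : a k.+1 != 0 by rewrite gt_eqF ?recurrence_a_gt0.
case: hP => _ _ /(_ k.+1 isT) /(congr1 (horner_mx A)) + _ _.
rewrite -[A *m _]/(A * _) rmorphM rmorphD /= !horner_mxZ horner_mx_X => ->.
by rewrite addrK scalerA mulVf // scale1r.
Qed.

(** Row [i] of [A] holds the coordinates of ['X * P i], and [e 0] those of [1]; truncation is not
    felt up to degree [N]. *)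
Lemma row_horner_recurrence k : (k <= N)%N -> e 0 *m horner_mx A (P k) = e k.
Proof.
suff: ((k <= N)%N -> e 0 *m horner_mx A (P k) = e k) /\
      ((k < N)%N -> e 0 *m horner_mx A (P k.+1) = e k.+1) by case.
case: (hP) => P0 P1 _ _ _; elim: k => [|k [IH1 IH2]]; split=> // kN.
- by rewrite P0 rmorph1 mulmx1.
- by rewrite P1 horner_mx_X eA0.
have a_neq0 : a k.+1 != 0 by rewrite gt_eqF ?recurrence_a_gt0.
rewrite horner_mx_recurrence -scalemxAr mulmxBr -scalemxAr.
have -> : A *m horner_mx A (P k.+1) = horner_mx A (P k.+1) *m A.
  exact/comm_mx_horner.
rewrite mulmxA IH2 ?(ltnW kN) // IH1 ?(ltnW (ltnW kN)) // eAS ?(ltnW kN) //.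
by rewrite addrK scalerA mulVf // scale1r.
Qed.

Let w := haar_inv a c.

(** Scaling the columns of [A] by [w] yields a symmetric matrix, so columns obey the row recurrence
    up to the weights [w]. *)
Lemma col_horner_recurrence k : (k <= N)%N ->
  horner_mx A (P k) *m (e 0)^T = w k *: (e k)^T.
Proof.
suff: ((k <= N)%N -> horner_mx A (P k) *m (e 0)^T = w k *: (e k)^T) /\
      ((k < N)%N -> horner_mx A (P k.+1) *m (e 0)^T = w k.+1 *: (e k.+1)^T).
  by case.
case: (hP) => P0 P1 _ _ _; elim: k => [|k [IH1 IH2]]; split=> // kN.
- by rewrite P0 rmorph1 mul1mx /w /haar_inv big_ord0 scale1r.
- by rewrite P1 horner_mx_X Ae0 /w /haar_inv big_ord1 /= divr1.
have a_neq0 : a k.+1 != 0 by rewrite gt_eqF ?recurrence_a_gt0.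
have b_neq0 : (if k == 0%N then 1 else a k) != 0.
  by case: (k) => [|l] /=; rewrite ?oner_eq0 // gt_eqF ?recurrence_a_gt0.
rewrite horner_mx_recurrence -scalemxAl mulmxBl -scalemxAl -mulmxA.
rewrite IH2 ?(ltnW kN) // IH1 ?(ltnW (ltnW kN)) //.
rewrite -scalemxAr AeS ?(ltnW kN) // !scalerDr scalerN !scalerA addrAC -scalerBl.
have wS j : w j.+1 = w j * (c j.+1 / (if j == 0%N then 1 else a j)).
  by rewrite /w /haar_inv big_ord_recr.
rewrite -!mulrA -mulrBr.
(* This is the symmetry relation; it cancels the component along [e k]. *)
have -> : w k.+1 * (if k == 0%N then 1 else a k) - c k.+1 * w k = 0.
  by rewrite wS -mulrA divfK // mulrC subrr.
by rewrite mulr0 scale0r add0r [w k.+2]wS /=; congr (_ *: _); field.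
Qed.

Lemma linearization0E (g : nat -> nat -> nat -> R) n :
  linearization_coefficients P g -> N = (n + n)%N -> g n n 0%N = haar_inv a c n.
Proof.
move=> hg NE; have nN : (n <= N)%N by rewrite NE leq_addr.
pose L p := (e 0 *m horner_mx A p *m (e 0)^T) 0 0.
have eE j k : (j <= N)%N -> (e j *m (e k)^T) 0 0 = (j == k)%:R.
  rewrite -ltnS => jN; rewrite mxE (bigD1 (Ordinal jN)) //= big1.
    by rewrite !mxE eqxx mul1r addr0.
  by move=> i; rewrite !mxE -val_eqE /= => /negPf ->; rewrite mul0r.
have LPP : L (P n * P n) = haar_inv a c n.
  rewrite /L rmorphM /= -mulmxA -[_ * _]/(_ *m _) -mulmxA.
  rewrite col_horner_recurrence // mulmxA row_horner_recurrence //.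
  by rewrite -scalemxAr mxE eE // eqxx mulr1.
rewrite -LPP hg /L rmorph_sum /= mulmx_sumr mulmx_suml summxE.
rewrite (bigD1 ord0) //= big1 => [|k k0].
  rewrite linearZ /= -scalemxAr -scalemxAl mxE row_horner_recurrence //.
  by rewrite eE // mulr1 addr0.
have kN : (k <= N)%N by rewrite NE -ltnS.
rewrite linearZ /= -scalemxAr -scalemxAl mxE row_horner_recurrence //.
by rewrite eE // -val_eqE in k0 *; rewrite (negPf k0) mulr0.
Qed.

End Recurrence.

(* Indispensable for the lower bound on [haar]: [1 / 0] is [0]. *)
Lemma linearization0_gt0 (R : realType) (a c : nat -> R) (P : nat -> {poly R})
    (g : nat -> nat -> nat -> R) n :
  recurrence_sequence a c P -> linearization_coefficients P g ->
  0 < g n n 0%N.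
Proof.
by move=> hP hg; rewrite (linearization0E hP hg erefl) (haar_inv_gt0 hP).
Qed.

(** * Averages over equidistributed angles *)

Section ChebyshevMean.
Variable R : realType.

(** Multiplying by [2 * sin t] with [t = k * pi / N] makes the sum telescope; [0 < t < pi] allows
    cancelling this factor. *)
Lemma sum_cos_equidistributed N k : (0 < k < N)%N ->
  \sum_(j < N) cos (k%:R * (j%:R * (pi *+ 2 / N%:R))) = 0 :> R.
Proof.
move=> /andP[k0 kN]; have N0 : 0 < N%:R :> R by rewrite ltr0n (leq_trans _ kN).
pose t : R := k%:R * (pi / N%:R).
have st : 0 < sin t.
  apply: sin_gt0_pi; rewrite /t; apply/andP; split.
    by rewrite mulr_gt0 ?ltr0n // divr_gt0 ?pi_gt0.
  by rewrite mulrCA gtr_pMr ?pi_gt0 // ltr_pdivrMr // mul1r ltr_nat.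
have telescope n : 2 * sin t * \sum_(j < n) cos (k%:R * (j%:R * (pi *+ 2 / N%:R)))
    = sin (t *+ 2 *+ n - t) + sin t.
  elim: n => [|n IH]; first by rewrite big_ord0 mulr0n add0r sinN addNr mulr0.
  rewrite big_ord_recr /= mulrDr IH.
  have -> : k%:R * (n%:R * (pi *+ 2 / N%:R)) = t *+ 2 *+ n.
    by rewrite /t; ring.
  have -> : t *+ 2 *+ n.+1 - t = t *+ 2 *+ n + t by rewrite mulrSr; ring.
  by rewrite sinB sinD; ring.
apply: (@mulfI _ (2 * sin t)); first by rewrite mulf_neq0 ?gt_eqF.
rewrite mulr0 telescope.
have -> : t *+ 2 *+ N = pi *+ 2 *+ k.
  by rewrite /t; field; rewrite gt_eqF.
by rewrite [_ - t]addrC (periodicn (@sinD2pi R)) sinN addNr.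
Qed.

Definition chebyshev_mean N (p : {poly R}) : R :=
  N%:R^-1 * \sum_(j < N) p.[cos (j%:R * (pi *+ 2 / N%:R))].

Lemma chebyshev_meanZ N b p :
  chebyshev_mean N (b *: p) = b * chebyshev_mean N p.
Proof.
rewrite /chebyshev_mean mulrCA; congr (_ * _); rewrite mulr_sumr.
by apply: eq_bigr => j _; rewrite hornerZ.
Qed.

Lemma chebyshev_mean_sum N n (p : 'I_n -> {poly R}) :
  chebyshev_mean N (\sum_i p i) = \sum_i chebyshev_mean N (p i).
Proof.
rewrite /chebyshev_mean -mulr_sumr exchange_big; congr (_ * _).
by apply: eq_bigr => j _; rewrite horner_sum.
Qed.

Variable T : nat -> {poly R}.
Hypothesis hT : chebyshev_first_kind T.

Lemma chebyshev_mean_T N k : (k < N)%N ->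
  chebyshev_mean N (T k) = (k == 0%N)%:R.
Proof.
move=> kN; rewrite /chebyshev_mean; under eq_bigr do rewrite hT.
case: k kN => [|k] kN; last by rewrite sum_cos_equidistributed ?mulr0.
under eq_bigr do rewrite mul0r cos0.
rewrite sumr_const card_ord mulVf // pnatr_eq0; lia.
Qed.

(** For [k <= j], [2 T j T k = T (j + k) + T (j - k)], and each term has mean [0] unless its index
    is [0]. *)
Lemma chebyshev_mean_TT N j k : (j + k < N)%N ->
  chebyshev_mean N (T j * T k) =
    2^-1 * ((j + k == 0)%N%:R + (j == k)%:R).
Proof.
wlog jk : j k / (k <= j)%N => [hw|] jkN.
  case: (leqP k j) => [kj|/ltnW jk]; first exact: hw.
  by rewrite mulrC addnC [j == k]eq_sym hw // addnC.
have -> : chebyshev_mean N (T j * T k) =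
    2^-1 * (chebyshev_mean N (T (j + k)) + chebyshev_mean N (T (j - k))).
  rewrite /chebyshev_mean -mulrDr mulrCA; congr (_ * _).
  rewrite -big_split mulr_sumr; apply: eq_bigr => i _ /=.
  rewrite hornerM !hT.
  move: (i%:R * _) => x; rewrite natrB // natrD mulrDl mulrBl cosD cosB.
  by field.
rewrite !chebyshev_mean_T; [|lia|lia].
by rewrite subn_eq0 [j == k]eqn_leq jk andbT.
Qed.

End ChebyshevMean.

(** * Bounds from nonnegative connection coefficients *)

Section NonnegativeConnection.
Variables (R : realType) (a c : nat -> R) (P T : nat -> {poly R}).
Variable (C : nat -> nat -> R).
Hypotheses (hP : recurrence_sequence a c P) (hT : chebyshev_first_kind T).
Hypothesis hC : connection_coefficients P T C.
Hypothesis C_ge0 : forall n k, (k <= n)%N -> 0 <= C n k.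

Lemma connection_horner_cos n x :
  (P n).[cos x] = \sum_(k < n.+1) C n k * cos (k%:R * x).
Proof.
by rewrite hC horner_sum; apply: eq_bigr => k _; rewrite hornerZ hT.
Qed.

Lemma connection_sum1 n : \sum_(k < n.+1) C n k = 1.
Proof.
rewrite -(recurrence_horner1 hP n) -cos0 connection_horner_cos.
by apply: eq_bigr => k _; rewrite mulr0 cos0 mulr1.
Qed.

Lemma connection0_le_half n : (0 < n)%N -> C n 0 <= 2^-1.
Proof.
case: n => // n _.
have [z [/andP[z0 z1] Pz _ _]] := recurrence_largest_root hP n.
have zE : cos (acos z) = z by rewrite acosK // in_itv /=; lra.
have := connection_sum1 n.+1; rewrite -{}zE connection_horner_cos in Pz.
move: Pz; rewrite big_ord_recl mul0r cos0 mulr1 [in X in _ -> X -> _]big_ord_recl /=.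
set s := (X in _ + X = 0); set u := (X in _ + X = 1).
(* Adding the expansions at the zero and at [1] gives [2 * C n 0 + s + u = 1]; the terms of [s + u]
   are multiples of [1 + cos]. *)
suff : 0 <= s + u by lra.
rewrite -big_split /=; apply: sumr_ge0 => k _.
rewrite -[X in _ + X]mulr1 -mulrDr; apply: mulr_ge0; first exact: C_ge0.
by have := cos_geN1 ((bump 0 k)%:R * acos z); lra.
Qed.

Lemma mean_square_le_half n : (0 < n)%N ->
  chebyshev_mean (n + n).+1 (P n * P n) <= 2^-1.
Proof.
move=> n0.
(* Only diagonal products survive; the last factor is [2] at [k = 0] and [1] elsewhere. *)
have -> : chebyshev_mean (n + n).+1 (P n * P n) =
   \sum_(k < n.+1) 2^-1 * (C n k ^+ 2 * ((val k == 0%N)%:R + 1)).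
  rewrite {1}hC mulr_suml chebyshev_mean_sum; apply: eq_bigr => j _.
  rewrite -scalerAl chebyshev_meanZ hC mulr_sumr chebyshev_mean_sum.
  rewrite (bigD1 j) //= big1 ?addr0 => [|k kj].
    rewrite -scalerAr chebyshev_meanZ (chebyshev_mean_TT hT); last first.
      have := ltn_ord j; lia.
    rewrite eqxx addnn double_eq0 -[true%:R]/1.
    by move: (_ == _)%:R => d; ring.
  rewrite -scalerAr chebyshev_meanZ (chebyshev_mean_TT hT); last first.
    have := ltn_ord j; have := ltn_ord k; lia.
  have jk : val j != val k by rewrite eq_sym.
  have -> : (j + k == 0)%N = false by apply/negP; move: jk => /=; lia.
  by rewrite (negPf jk) addr0 !mulr0.
rewrite -mulr_sumr ler_piMr ?invr_ge0 // -[leRHS](connection_sum1 n).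
apply: ler_sum => k _; have Ck : 0 <= C n k by rewrite C_ge0 // -ltnS.
rewrite expr2 -mulrA ler_piMr //.
(* At [k = 0] the factor [2] is absorbed by [C n 0 <= 1/2]; otherwise [C n k <= 1] suffices. *)
case: eqP => [->|_].
  by have := connection0_le_half n0; rewrite -[true%:R]/1; lra.
rewrite add0r mulr1 -[leRHS](connection_sum1 n) (bigD1 k) //= lerDl.
by apply: sumr_ge0 => i _; rewrite C_ge0 // -ltnS.
Qed.

Lemma linearization0_le_mean (g : nat -> nat -> nat -> R) n :
  nonneg_linearization P g ->
  g n n 0%N <= chebyshev_mean (n + n).+1 (P n * P n).
Proof.
move=> [hg g_ge0]; rewrite hg chebyshev_mean_sum.
have mean_P k : (k < (n + n).+1)%N ->
    chebyshev_mean (n + n).+1 (P k) = C k 0.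
  move=> kN; rewrite hC chebyshev_mean_sum big_ord_recl chebyshev_meanZ.
  rewrite (chebyshev_mean_T hT) // mulr1 big1 ?addr0 // => i _.
  rewrite chebyshev_meanZ (chebyshev_mean_T hT) ?mulr0 //.
  by rewrite /= /bump; have := ltn_ord i; lia.
rewrite (bigD1 ord0) //= chebyshev_meanZ mean_P //.
have -> : C 0 0 = 1 by rewrite -(connection_sum1 0) big_ord1.
rewrite mulr1 lerDl; apply: sumr_ge0 => k _.
rewrite chebyshev_meanZ mean_P //; apply: mulr_ge0; last exact: C_ge0.
by apply: g_ge0; rewrite -ltnS.
Qed.

End NonnegativeConnection.

Theorem corollary2p1 (R : realType) (a c : nat -> R) (P T : nat -> {poly R})
    (g : nat -> nat -> nat -> R) (C : nat -> nat -> R)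
    (hP : recurrence_sequence a c P)
    (hg : nonneg_linearization P g)
    (hT : chebyshev_first_kind T)
    (hC : connection_coefficients P T C)
    (C_ge0 : forall n k : nat, (k <= n)%N -> 0 <= C n k) :
  forall n : nat, (1 <= n)%N -> 2 <= haar g n.
Proof.
move=> n n0; rewrite /haar.
have g_gt0 := linearization0_gt0 n hP hg.1.
have := linearization0_le_mean hP hT hC C_ge0 n hg.
have := mean_square_le_half hP hT hC C_ge0 n0.
rewrite ler_pdivlMr //; lra.
Qed.
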